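(* Let $\Pi=(\mathsf P_1,\mathsf P_2,\mathsf V)$ be a $\Xi$-protocol with 1-bit challenges for a language $L$, with soundness error $\frac12$ against quantum adversaries. Then $\mathsf{NIP}[\Pi]$ (with $k$ repetitions) is a sound quantum non-interactive proof for $L$ with soundness error $\frac{1}{2^k}$: for every malicious prover (with no bound on its computational power or quantum memory) and every $x\notin L$, the honest verifier of $\mathsf{NIP}[\Pi]$ accepts with probability at most $2^{-k}$.
   Context: Notation: for bits $x,\theta$, $|x\rangle_\theta = H^\theta|x\rangle$ with $H$ the Hadamard matrix; basis $0$ is also denoted $+$ and basis $1$ is denoted $\times$; the notation extends bitwise to strings. $\Xi$-protocol with 1-bit challenges: (1) the prover, on input $x$ and a witness, uses $\mathsf P_1$ to compute a state $|\phi\rangle_{AB}$ and sends register $A$ to the verifier (the message may be quantum); (2) the verifier sends a uniformly random challenge $c\in\{0,1\}$; (3) the prover uses $\mathsf P_2$ to compute a classical response $r$ from its remaining register $B$ and $c$, and sends $r$; (4) the verifier accepts iff $\mathsf V(x,\phi_A,c,r)=1$. We consider $\Xi$-protocols in which the honest verifier measures the first message upon reception in a way depending on $c$, obtaining an outcome $a$, and applies its predicate $\mathsf V(a,c,r)$ to that outcome. A proof system has soundness error $\epsilon$ if for every $x\notin L$ and every malicious prover the verifier accepts with probability at most $\epsilon$. Protocol $\mathsf{NIP}[\Pi]$ with $k$ repetitions. Prover: for each $i\in[k]$, prepare an $n$-qubit state $|x_i\rangle_{\theta_i}$ for random $x_i,\theta_i\in\{0,1\}^n$; compute a first message $|\phi_i\rangle$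 with $\mathsf P_1$ using fresh randomness; compute the responses $r_i^0,r_i^1$ to both challenges with $\mathsf P_2$; sample two universal$_2$ hash functions $h_i^0,h_i^1$; set $m_i^0=r_i^0\oplus h_i^0(x_i^+)$ and $m_i^1=r_i^1\oplus h_i^1(x_i^\times)$, where $x_i^+$ (resp. $x_i^\times$) is the substring of $x_i$ at positions where $\theta_i$ is $+$ (resp. $\times$). Send all the $|\phi_i\rangle|x_i\rangle_{\theta_i}$; then (after the point where a memory bound on a malicious verifier would apply) send the classical values $(\theta_i,h_i^0,h_i^1,m_i^0,m_i^1)_{i\in[k]}$. Verifier: pick random bits $c_1,\dots,c_k$; for each $i$, measure every qubit of the $i$-th $n$-qubit state in basis $c_i$, obtaining $x_i'$, and measure $|\phi_i\rangle$ according to $\mathsf V$ with challenge $c_i$, obtaining $a_i$; use $\theta_i$ to extract from $x'_i$ the substring at positions encoded in basis $c_i$, and unmask $m_i^{c_i}$ with $h_i^{c_i}$ of that substring to get $r_i^{c_i}$; accept iff $\mathsf V(a_i,c_i,r_i^{c_i})=1$ for all $i\in[k]$. *)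

(* Defs.v *)
From HB Require Import structures.
From mathcomp Require Import all_boot all_order all_algebra.
From mathcomp Require Import spectral sesquilinear.
From mathcomp Require Import reals complex.

Set Implicit Arguments.
Unset Strict Implicit.
Unset Printing Implicit Defensive.
Import Order.TTheory GRing.Theory Num.Theory.
Local Open Scope ring_scope.
Local Open Scope sesquilinear_scope.

Definition bits (n : nat) := {ffun 'I_n -> bool}.

Definition xorb_bits l (r s : bits l) : bits l := [ffun i => r i (+) s i].

Definition swap_mid (A B C D : finType) (p : (A * C) * (B * D)) :
  (A * B) * (C * D) := ((p.1.1, p.2.1), (p.1.2, p.2.2)).

Lemma swap_mid_bij (A B C D : finType) : bijective (@swap_mid A B C D).
Proof.
by exists (fun p => ((p.1.1, p.2.1), (p.1.2, p.2.2))); move=> [[? ?] [? ?]].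
Qed.

Definition zip_ffun (I A B : finType) (p : {ffun I -> A} * {ffun I -> B}) :
  {ffun I -> A * B} := [ffun i => (p.1 i, p.2 i)].

Lemma zip_ffun_bij (I A B : finType) : bijective (@zip_ffun I A B).
Proof.
exists (fun f : {ffun I -> A * B} =>
  ([ffun i => (f i).1] : {ffun I -> A}, [ffun i => (f i).2] : {ffun I -> B})).
  by move=> [f g]; congr pair; apply/ffunP => i; rewrite !ffunE.
by move=> f; apply/ffunP => i; rewrite !ffunE /= -surjective_pairing.
Qed.

(** Finite-dimensional quantum mechanics. A register is given by the finite
    type [T] labelling its computational basis; its state space is [C^T], and
    its operators are the square matrices of size [#|T|], read through the
    enumeration of [T]. The register made of [S] and [T] is [S * T], and the
    one made of copies of [T] indexed by [I] is [{ffun I -> T}]. *)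
Section Operators.
Variable C : numClosedFieldType.

Definition qop (T : finType) := 'M[C]_#|T|.

Definition qent (T : finType) (A : qop T) (s t : T) : C :=
  A (enum_rank s) (enum_rank t).

Definition qmx (T : finType) (f : T -> T -> C) : qop T :=
  \matrix_(i, j) f (enum_val i) (enum_val j).

Definition qproj (T : finType) (x : T) : qop T :=
  qmx (fun s t => ((s == x) && (t == x))%:R).

Definition qtens (S T : finType) (A : qop S) (B : qop T) : qop (S * T)%type :=
  qmx (fun s t => qent A s.1 t.1 * qent B s.2 t.2).

Definition qtensn (I T : finType) (F : I -> qop T) : qop {ffun I -> T} :=
  qmx (fun s t : {ffun I -> T} => \prod_i qent (F i) (s i) (t i)).

Definition qrelabel (S T : finType) (f : S -> T) (A : qop T) : qop S :=
  qmx (fun s t => qent A (f s) (f t)).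

Definition hadamard : qop bool :=
  qmx (fun a b : bool => (-1) ^+ (a && b) / sqrtC 2%:R).

Definition psd (T : finType) (A : qop T) : Prop :=
  A \is hermsymmx /\
  forall u : 'rV[C]_#|T|, 0 <= (u *m A *m u ^t*) 0 0.

Section Entries.
Variables (T : finType).
Implicit Types (A B : qop T) (s t : T).

Lemma qentE f s t : qent (qmx f : qop T) s t = f s t.
Proof. by rewrite /qent mxE !enum_rankK. Qed.

Lemma qopP A B : (forall s t, qent A s t = qent B s t) -> A = B.
Proof.
move=> eqAB; apply/matrixP => i j.
by have := eqAB (enum_val i) (enum_val j); rewrite /qent !enum_valK.
Qed.

Lemma sum_rank (F : 'I_#|T| -> C) : \sum_i F i = \sum_t F (enum_rank t).
Proof. by rewrite (reindex _ (onW_bij _ (@enum_rank_bij T))). Qed.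

Lemma qent_mul A B s t : qent (A *m B) s t = \sum_u qent A s u * qent B u t.
Proof. by rewrite /qent mxE sum_rank. Qed.

Lemma qent_adj A s t : qent (A ^t*) s t = (qent A t s)^*.
Proof. by rewrite /qent !mxE. Qed.

Lemma qent1 s t : qent (1%:M : qop T) s t = (s == t)%:R.
Proof. by rewrite /qent mxE (inj_eq enum_rank_inj). Qed.

Lemma qent_sum (I : finType) (P : pred I) (F : I -> qop T) s t :
  qent (\sum_(i | P i) F i) s t = \sum_(i | P i) qent (F i) s t.
Proof. by rewrite /qent summxE. Qed.

Lemma qtraceE A : \tr A = \sum_s qent A s s.
Proof. by rewrite /mxtrace sum_rank. Qed.

Lemma qproj_adj (x : T) : (qproj x) ^t* = qproj x.
Proof.
by apply: qopP => s t; rewrite qent_adj !qentE conjC_nat andbC.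
Qed.

Lemma qproj_idem (x : T) : qproj x *m qproj x = qproj x.
Proof.
apply: qopP => s t; rewrite qent_mul (bigD1 x) //= big1 => [|u /negPf nux].
  by rewrite !qentE eqxx andbT addr0 -natrM mulnb.
by rewrite !qentE nux andbF mul0r.
Qed.

Lemma qproj_sum : \sum_x qproj x = 1%:M :> qop T.
Proof.
apply: qopP => s t; rewrite qent_sum qent1 (bigD1 s) //= big1 => [|u nus].
  by rewrite qentE eqxx addr0 eq_sym.
by rewrite qentE eq_sym (negPf nus).
Qed.

Lemma qproj_tr (x : T) : \tr (qproj x) = 1.
Proof.
rewrite qtraceE (bigD1 x) //= big1 => [|u /negPf nux]; last by rewrite qentE nux.
by rewrite qentE eqxx addr0.
Qed.

Lemma hermE n (A : 'M[C]_n) : (A \is hermsymmx) = (A == A ^t*).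
Proof. by rewrite is_hermitianmxE expr0 scale1r. Qed.

Lemma psd_gram m (G : 'M[C]_(m, #|T|)) : psd (G ^t* *m G : qop T).
Proof.
split.
  by rewrite hermE trmx_mul map_mxM /= trmxCK.
move=> u; rewrite mulmxA -mulmxA.
have -> : G *m u ^t* = (u *m G ^t*) ^t*.
  by rewrite trmx_mul map_mxM /= trmxCK.
by rewrite mxE sumr_ge0 // => i _; rewrite !mxE mul_conjC_ge0.
Qed.

Lemma gram_psd A : psd A -> exists G : qop T, A = G ^t* *m G.
Proof.
move=> [hA pA]; have /orthomx_spectralP eA := hermitian_normalmx hA.
set P := spectralmx A in eA; set d := spectral_diag A in eA.
have uP : P \is unitarymx by exact: spectral_unitarymx.
have PP : P *m P ^t* = 1%:M by apply/unitarymxP.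
rewrite invmx_unitary // in eA.
have d_ge0 i : 0 <= d 0 i.
  have := pA (row i P).
  suff -> : row i P *m A *m (row i P) ^t* = (d 0 i)%:M by rewrite mxE eqxx mulr1n.
  have eD : P *m A *m P ^t* = diag_mx d.
    by rewrite eA !mulmxA PP mul1mx -mulmxA PP mulmx1.
  have -> : row i P *m A *m (row i P) ^t* = \matrix_(_, _) (diag_mx d) i i.
    rewrite -eD -row_mul; apply/matrixP => a b; rewrite !mxE.
    by apply: eq_bigr => j _; rewrite !mxE.
  by apply/matrixP => a b; rewrite !mxE eqxx !ord1 eqxx !mulr1n.
exists (diag_mx (map_mx sqrtC d) *m P).
rewrite trmx_mul map_mxM !mulmxA {1}eA -[X in X *m P]mulmxA; congr (_ *m _ *m _).
rewrite tr_diag_mx map_diag_mx mulmx_diag; congr diag_mx.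
apply/rowP => j; rewrite !mxE.
rewrite /= conj_Creal; last by rewrite ger0_real // sqrtC_ge0.
by rewrite -expr2 sqrtCK.
Qed.

End Entries.

Lemma qtens_mul (S T : finType) (A A' : qop S) (B B' : qop T) :
  qtens A B *m qtens A' B' = qtens (A *m A') (B *m B').
Proof.
apply: qopP => s t; rewrite qent_mul !qentE !qent_mul big_distrlr pair_bigA /=.
by apply: eq_bigr => u _; rewrite !qentE mulrACA.
Qed.

Lemma qtens_adj (S T : finType) (A : qop S) (B : qop T) :
  (qtens A B) ^t* = qtens (A ^t*) (B ^t*).
Proof. by apply: qopP => s t; rewrite qent_adj !qentE !qent_adj rmorphM. Qed.

Lemma qtens1 (S T : finType) :
  qtens (1%:M : qop S) (1%:M : qop T) = 1%:M.
Proof.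
by apply: qopP => s t; rewrite qentE !qent1 -natrM mulnb -xpair_eqE -!surjective_pairing.
Qed.

Lemma qtens_sum (S T I J : finType) (F : I -> qop S) (G : J -> qop T) :
  \sum_ij qtens (F ij.1) (G ij.2) = qtens (\sum_i F i) (\sum_j G j).
Proof.
apply: qopP => s t; rewrite qent_sum qentE !qent_sum big_distrlr pair_bigA /=.
by apply: eq_bigr => u _; rewrite qentE.
Qed.

Lemma qtens_tr (S T : finType) (A : qop S) (B : qop T) :
  \tr (qtens A B) = \tr A * \tr B.
Proof.
rewrite !qtraceE big_distrlr pair_bigA /=.
by apply: eq_bigr => u _; rewrite qentE.
Qed.

Lemma qtensn_mul (I T : finType) (F G : I -> qop T) :
  qtensn F *m qtensn G = qtensn (fun i => F i *m G i).
Proof.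
apply: qopP => s t; rewrite qent_mul qentE.
under [RHS]eq_bigr => i _ do rewrite qent_mul.
rewrite bigA_distr_bigA; apply: eq_bigr => u _.
by rewrite !qentE -big_split.
Qed.

Lemma qtensn_adj (I T : finType) (F : I -> qop T) :
  (qtensn F) ^t* = qtensn (fun i => (F i) ^t*).
Proof.
apply: qopP => s t; rewrite qent_adj !qentE rmorph_prod.
by apply: eq_bigr => i _; rewrite qent_adj.
Qed.

Lemma qtensn1 (I T : finType) : qtensn (fun _ : I => 1%:M : qop T) = 1%:M.
Proof.
apply: qopP => s t; rewrite qentE qent1.
have [->|/eqP nst] := eqVneq s t.
  by rewrite big1 // => i _; rewrite qent1 eqxx.
have [i nsti] : exists i, s i != t i.
  apply/existsP; rewrite -negb_forall; apply/negP => /forallP eqst.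
  by apply: nst; apply/ffunP => i; apply/eqP.
by rewrite (bigD1 i) //= qent1 (negPf nsti) mul0r.
Qed.

Lemma qtensn_sum (I J T : finType) (F : I -> J -> qop T) :
  \sum_(f : {ffun I -> J}) qtensn (fun i => F i (f i)) =
  qtensn (fun i => \sum_j F i j).
Proof.
apply: qopP => s t; rewrite qent_sum qentE.
under [RHS]eq_bigr => i _ do rewrite qent_sum.
by rewrite bigA_distr_bigA; apply: eq_bigr => f _; rewrite qentE.
Qed.

Lemma qtensn_tr (I T : finType) (F : I -> qop T) :
  \tr (qtensn F) = \prod_i \tr (F i).
Proof.
rewrite qtraceE; under [RHS]eq_bigr => i _ do rewrite qtraceE.
by rewrite bigA_distr_bigA; apply: eq_bigr => f _; rewrite qentE.
Qed.

Lemma eq_qtensn (I T : finType) (F G : I -> qop T) :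
  F =1 G -> qtensn F = qtensn G.
Proof.
move=> eFG; apply: qopP => s t; rewrite !qentE.
by apply: eq_bigr => i _; rewrite eFG.
Qed.

Lemma psd_tens (S T : finType) (A : qop S) (B : qop T) :
  psd A -> psd B -> psd (qtens A B).
Proof.
move=> /gram_psd[G ->] /gram_psd[H ->].
by rewrite -qtens_mul -qtens_adj; exact: psd_gram.
Qed.

Lemma psd_tensn (I T : finType) (F : I -> qop T) :
  (forall i, psd (F i)) -> psd (qtensn F).
Proof.
move=> pF; have /fin_all_exists[G eG] := fun i => gram_psd (pF i).
rewrite (eq_qtensn eG) -qtensn_mul -qtensn_adj; exact: psd_gram.
Qed.

Lemma psd_relabel (S T : finType) (f : S -> T) (A : qop T) :
  psd A -> psd (qrelabel f A).
Proof.
move=> /gram_psd[G ->].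
pose G' : 'M[C]_(#|T|, #|S|) := \matrix_(i, j) G i (enum_rank (f (enum_val j))).
suff -> : qrelabel f (G ^t* *m G) = G' ^t* *m G' by exact: psd_gram.
apply/matrixP => i j; rewrite !mxE /qent !mxE.
by apply: eq_bigr => l _; rewrite !mxE.
Qed.

Lemma qrelabel_tr (S T : finType) (f : S -> T) (A : qop T) :
  bijective f -> \tr (qrelabel f A) = \tr A.
Proof.
move=> bf; rewrite !qtraceE [RHS](reindex _ (onW_bij _ bf)).
by apply: eq_bigr => s _; rewrite qentE.
Qed.

Lemma psd_avg (T I : finType) (F : I -> qop T) :
  (forall i, psd (F i)) -> psd (#|I|%:R^-1 *: \sum_i F i).
Proof.
move=> pF; split.
  rewrite hermE linearZ /= map_mxZ fmorphV rmorph_nat; apply/eqP.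
  congr (_ *: _); apply/matrixP => i j; rewrite !mxE !summxE rmorph_sum.
  apply: eq_bigr => l _; have [+ _] := pF l; rewrite hermE => /eqP {1}->.
  by rewrite !mxE.
move=> u; rewrite -scalemxAr -scalemxAl mxE mulr_ge0 ?invr_ge0 ?ler0n //.
rewrite mulmx_sumr mulmx_suml summxE sumr_ge0 // => i _.
by have [_] := pF i; apply.
Qed.

Lemma hadamard_adj : hadamard ^t* = hadamard.
Proof.
apply: qopP => s t; rewrite qent_adj !qentE andbC rmorphM rmorph_sign /=.
by rewrite conj_Creal // ger0_real // invr_ge0 sqrtC_ge0 ler0n.
Qed.

Lemma hadamard_sqr : hadamard *m hadamard = 1%:M.
Proof.
apply: qopP => s t; rewrite qent_mul qent1 big_bool !qentE.
rewrite -[LHS]/(_ + _) !andbT !andbF !andTb !andFb !expr0.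
rewrite mulrACA [X in _ + X]mulrACA -mulrDl -invfM -(expr2 (sqrtC _)) sqrtCK ?mulr1.
case: s; case: t; rewrite ?expr0 ?expr1 ?mulrNN ?mulr1 ?mul1r ?addNr ?mul0r //.
  by rewrite -[1 + 1]/(2%:R) divff // pnatr_eq0.
by rewrite -[1 + 1]/(2%:R) divff // pnatr_eq0.
Qed.

Record density (T : finType) := Density {
  density_op :> qop T;
  density_psd : psd density_op;
  density_tr : \tr density_op = 1 }.

Definition dtens (S T : finType) (r : density S) (s : density T) :
  density (S * T)%type.
Proof.
by exists (qtens r s); [apply: psd_tens; exact: density_psd
  | rewrite qtens_tr !density_tr mulr1].
Defined.

Definition dtensn (I T : finType) (r : I -> density T) : density {ffun I -> T}.
Proof.
exists (qtensn (fun i => r i)); first by apply: psd_tensn => i; exact: density_psd.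
by rewrite qtensn_tr big1 // => i _; rewrite density_tr.
Defined.

Definition drelabel (S T : finType) (f : S -> T) (bf : bijective f)
  (r : density T) : density S.
Proof.
by exists (qrelabel f r); [apply: psd_relabel; exact: density_psd
  | rewrite qrelabel_tr // density_tr].
Defined.

Definition davg (T I : finType) (I0 : (0 < #|I|)%N) (r : I -> density T) :
  density T.
Proof.
exists (#|I|%:R^-1 *: \sum_i (r i : qop T)).
  by apply: psd_avg => i; exact: density_psd.
rewrite linearZ linear_sum /=.
under eq_bigr => i _ do rewrite density_tr.
by rewrite sumr_const mulVf // pnatr_eq0 -lt0n.
Defined.

Definition dbasis (T : finType) (x : T) : density T.
Proof.
by exists (qproj x); [rewrite -qproj_idem -{1}qproj_adj; exact: psd_gram
  | exact: qproj_tr].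
Defined.

(** Quantum measurements in the sense of Nielsen and Chuang: on a state [r],
    outcome [o] has probability [tr (M_o r M_o^* )] and leaves the state
    proportional to [M_o r M_o^*]. *)
Record measurement (T O : finType) := Measurement {
  meas_op :> O -> qop T;
  meas_complete : \sum_o (meas_op o) ^t* *m meas_op o = 1%:M }.

Definition mtens (S T O P : finType)
  (M : measurement S O) (N : measurement T P) :
  measurement (S * T)%type (O * P)%type.
Proof.
exists (fun op => qtens (M op.1) (N op.2)).
under eq_bigr => op _ do rewrite qtens_adj qtens_mul.
rewrite (qtens_sum (fun o => (M o) ^t* *m M o) (fun p => (N p) ^t* *m N p)).
by rewrite !meas_complete qtens1.
Defined.

Definition mtensn (I T O : finType) (M : I -> measurement T O) :
  measurement {ffun I -> T} {ffun I -> O}.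
Proof.
exists (fun f : {ffun I -> O} => qtensn (fun i => M i (f i))).
under eq_bigr => f _ do rewrite qtensn_adj qtensn_mul.
rewrite (qtensn_sum (fun i o => (M i o) ^t* *m M i o)).
rewrite (@eq_qtensn I T _ (fun _ => 1%:M)) ?qtensn1 // => i.
exact: meas_complete.
Defined.

(* [M] first, then [N] on the post-measurement state *)
Definition mseq (T O P : finType) (M : measurement T O) (N : measurement T P) :
  measurement T (O * P)%type.
Proof.
exists (fun op => N op.2 *m M op.1).
rewrite -(pair_bigA _ (fun o p => (N p *m M o) ^t* *m (N p *m M o))) /=.
rewrite -[RHS](meas_complete M); apply: eq_bigr => o _.
under eq_bigr => p _ do rewrite trmx_mul map_mxM mulmxA -[_ *m N p]mulmxA.
by rewrite -mulmx_suml -mulmx_sumr meas_complete mulmx1.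
Defined.

Definition mbasis (T : finType) : measurement T T.
Proof.
exists (@qproj T); under eq_bigr => x _ do rewrite qproj_adj qproj_idem.
exact: qproj_sum.
Defined.

(** [H^theta |x><x| H^theta]; [theta = false] is the basis [+], and
    [theta = true] the diagonal basis. *)
Definition qubit_proj (theta x : bool) : qop bool :=
  hadamard ^+ theta *m qproj x *m hadamard ^+ theta.

Lemma hadamardX_adj (c : bool) : (hadamard ^+ c) ^t* = hadamard ^+ c.
Proof.
case: c; first by rewrite expr1 hadamard_adj.
by rewrite expr0 trmx1 map_mx1.
Qed.

Lemma hadamardX_sqr (c : bool) : hadamard ^+ c *m hadamard ^+ c = 1%:M.
Proof.
case: c; first by rewrite expr1 hadamard_sqr.
by rewrite expr0 mulmx1.
Qed.

Lemma qubit_proj_adj c x : (qubit_proj c x) ^t* = qubit_proj c x.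
Proof.
by rewrite /qubit_proj !trmx_mul !map_mxM !hadamardX_adj qproj_adj mulmxA.
Qed.

Lemma qubit_proj_idem c x : qubit_proj c x *m qubit_proj c x = qubit_proj c x.
Proof.
rewrite /qubit_proj !mulmxA -[_ *m hadamard ^+ c *m hadamard ^+ c]mulmxA.
by rewrite hadamardX_sqr mulmx1 -[_ *m qproj x *m qproj x]mulmxA qproj_idem.
Qed.

Definition qubit_state (theta x : bool) : density bool.
Proof.
exists (qubit_proj theta x).
  by rewrite -qubit_proj_idem -{1}qubit_proj_adj; exact: psd_gram.
by rewrite /qubit_proj mxtrace_mulC mulmxA hadamardX_sqr mul1mx qproj_tr.
Defined.

Definition qubit_meas (c : bool) : measurement bool bool.
Proof.
exists (qubit_proj c).
under eq_bigr => x _ do rewrite qubit_proj_adj qubit_proj_idem.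
by rewrite -mulmx_suml -mulmx_sumr qproj_sum mulmx1 hadamardX_sqr.
Defined.

Definition bb84_state n (theta x : bits n) : density (bits n) :=
  dtensn (fun j => qubit_state (theta j) (x j)).

Definition bb84_meas n (c : bool) : measurement (bits n) (bits n) :=
  mtensn (fun _ : 'I_n => qubit_meas c).

End Operators.

Section Protocols.
Variable R : realType.
Local Notation density := (density R[i]).
Local Notation measurement := (measurement R[i]).

Definition born (T O : finType) (r : density T) (M : measurement T O) (o : O) : R :=
  complex.Re (\tr (M o *m density_op r *m (M o) ^t*)).

Definition instance := seq bool.
Definition witness := seq bool.

(** A Xi-protocol with 1-bit challenges. On instance [x], [P1] maps a witness to
    the joint state of the first message and of the prover's memory (random
    coins of [P1], if any, belong to the memory), and [P2] measures the memory to
    get the response; the verifier measures the first message according to the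
    challenge [c] and applies a predicate to the outcome. *)
Record xi_protocol := XiProtocol {
  xi_reg : instance -> finType;
  xi_mem : instance -> finType;
  xi_out : instance -> finType;
  xi_len : instance -> nat;
  P1 : forall x, witness -> density (xi_reg x * xi_mem x)%type;
  P2 : forall x (c : bool), measurement (xi_mem x) (bits (xi_len x));
  Vmeas : forall x (c : bool), measurement (xi_reg x) (xi_out x);
  V : forall x, xi_out x -> bool -> bits (xi_len x) -> bool }.

(** An arbitrary prover strategy: a memory of any finite dimension, possibly
    entangled with the message on register [A], and for each challenge a
    measurement of the memory whose outcome is post-processed into a response. *)
Record xi_prover (A Rsp : finType) := XiProver {
  xp_mem : finType;
  xp_out : finType;
  xp_state : density (A * xp_mem)%type;
  xp_meas : bool -> measurement xp_mem xp_out;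
  xp_resp : bool -> xp_out -> Rsp }.
Arguments xp_resp {A Rsp} P c o : rename.

Definition xi_accept (Pi : xi_protocol) (x : instance)
  (P : xi_prover (xi_reg Pi x) (bits (xi_len Pi x))) : R :=
  2^-1 * \sum_(c : bool)
    \sum_(ao : xi_out Pi x * xp_out P | V ao.1 c (xp_resp P c ao.2))
      born (xp_state P) (mtens (Vmeas Pi x c) (xp_meas P c)) ao.

Definition xi_soundness_error (L : instance -> Prop) (Pi : xi_protocol)
  (eps : R) : Prop :=
  forall x, ~ L x ->
  forall P : xi_prover (xi_reg Pi x) (bits (xi_len Pi x)), xi_accept P <= eps.

(** Prover strategy in a non-interactive proof: send the register [Q] of a joint
    state, then measure the memory and compute a classical message from the
    outcome. *)
Record qnip_prover (Q W : finType) := QnipProver {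
  qp_mem : finType;
  qp_out : finType;
  qp_state : density (Q * qp_mem)%type;
  qp_meas : measurement qp_mem qp_out;
  qp_msg : qp_out -> W }.
Arguments qp_msg {Q W} P o : rename.

(** A quantum non-interactive proof: one quantum message followed by one classical
    message. The verifier draws uniform coins, measures the quantum message
    according to them upon reception, and decides after the classical message. *)
Record qnip := Qnip {
  qn_reg : instance -> finType;
  qn_msg : instance -> finType;
  qn_coins : instance -> finType;
  qn_out : instance -> finType;
  qn_prover : forall x, witness -> qnip_prover (qn_reg x) (qn_msg x);
  qn_meas : forall x, qn_coins x -> measurement (qn_reg x) (qn_out x);
  qn_dec : forall x, qn_coins x -> qn_out x -> qn_msg x -> bool }.

Definition qnip_accept (N : qnip) (x : instance)
  (P : qnip_prover (qn_reg N x) (qn_msg N x)) : R :=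
  #|qn_coins N x|%:R^-1 * \sum_(c : qn_coins N x)
    \sum_(ao : qn_out N x * qp_out P | qn_dec c ao.1 (qp_msg P ao.2))
      born (qp_state P) (mtens (qn_meas c) (qp_meas P)) ao.

Definition qnip_soundness_error (L : instance -> Prop) (N : qnip)
  (eps : R) : Prop :=
  forall x, ~ L x ->
  forall P : qnip_prover (qn_reg N x) (qn_msg N x), qnip_accept P <= eps.

(** A family of functions to [l]-bit strings whose restriction to the strings of
    each fixed length at most [n] is universal_2: the length of the string to hash
    varies, but is determined by [theta]. *)
Record hash_family (n l : nat) := HashFamily {
  hkey : finType;
  hfun : hkey -> seq bool -> bits l;
  hkey_gt0 : (0 < #|hkey|)%N;
  hfun_universal : forall s t : seq bool, size s = size t -> (size s <= n)%N ->
    s != t -> (#|[set h | hfun h s == hfun h t]| * 2 ^ l <= #|hkey|)%N }.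

Section NIP.
Variables (k n : nat) (Pi : xi_protocol).
Variable hash : forall x, hash_family n (xi_len Pi x).

(* the substring of [x] at the positions encoded in basis [c] *)
Definition sub_basis (theta x : bits n) (c : bool) : seq bool :=
  [seq x j | j <- enum 'I_n & theta j == c].

Section Instance.
Variable x : instance.
Local Notation Rsp := (bits (xi_len Pi x)).
Local Notation H := (hash x).

(* [(theta_i, h_i, m_i)], with [h_i^c = h_i c] and [m_i^c = m_i c] *)
Definition nip_msg1 : finType :=
  (bits n * {ffun bool -> hkey H} * {ffun bool -> Rsp})%type.

Definition nip_reg1 : finType := (xi_reg Pi x * bits n)%type.

(* the prover's coins [(x_i, theta_i, h_i)] *)
Definition nip_rand1 : finType :=
  (bits n * bits n * {ffun bool -> hkey H})%type.

Lemma nip_rand1_gt0 : (0 < #|nip_rand1|)%N.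
Proof. by rewrite !card_prod !card_ffun !muln_gt0 !expn_gt0 card_bool hkey_gt0. Qed.

(* [|x_i>_theta_i], next to a classical record of the uniform coins *)
Definition nip_bb84 : density (bits n * nip_rand1)%type :=
  davg nip_rand1_gt0 (fun rd : nip_rand1 =>
    dtens (bb84_state R[i] rd.1.2 rd.1.1) (dbasis R[i] rd)).

Definition nip_mem1 : finType := (xi_mem Pi x * nip_rand1)%type.

Definition nip_state1 (w : witness) : density (nip_reg1 * nip_mem1)%type :=
  drelabel (@swap_mid_bij _ _ _ _) (dtens (P1 Pi x w) nip_bb84).

(* compute [r_i^0], then [r_i^1], and read the coins *)
Definition nip_meas1 : measurement nip_mem1 ((Rsp * Rsp) * nip_rand1)%type :=
  mtens (mseq (P2 Pi x false) (P2 Pi x true)) (mbasis R[i] nip_rand1).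

Definition nip_mask1 (o : (Rsp * Rsp) * nip_rand1) : nip_msg1 :=
  let: ((r0, r1), (xs, theta, h)) := o in
  (theta, h, [ffun c : bool =>
    xorb_bits (if c then r1 else r0) (hfun (h c) (sub_basis theta xs c))]).

Definition nip_honest (w : witness) :
  qnip_prover {ffun 'I_k -> nip_reg1} {ffun 'I_k -> nip_msg1} :=
  {| qp_state := drelabel (@zip_ffun_bij _ _ _)
                   (dtensn (fun _ : 'I_k => nip_state1 w));
     qp_meas := mtensn (fun _ : 'I_k => nip_meas1);
     qp_msg := fun o : {ffun 'I_k -> _} => [ffun i => nip_mask1 (o i)] |}.

Definition nip_out1 : finType := (xi_out Pi x * bits n)%type.

Definition nip_meas (c : bits k) :
  measurement {ffun 'I_k -> nip_reg1} {ffun 'I_k -> nip_out1} :=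
  mtensn (fun i : 'I_k => mtens (Vmeas Pi x (c i)) (bb84_meas R[i] n (c i))).

Definition nip_dec (c : bits k) (o : {ffun 'I_k -> nip_out1})
  (m : {ffun 'I_k -> nip_msg1}) : bool :=
  [forall i, let: (a, xs) := o i in let: (theta, h, mi) := m i in
    V a (c i) (xorb_bits (mi (c i)) (hfun (h (c i)) (sub_basis theta xs (c i))))].

End Instance.

Definition NIP : qnip :=
  {| qn_prover := nip_honest; qn_meas := nip_meas; qn_dec := nip_dec |}.

End NIP.
End Protocols.

(* Main.v *)
(** Once the classical message is fixed, the verifier measures each of the [k]
    blocks independently, so the acceptance operator averaged over the challenges
    is [2^-k] times the tensor product of the operators [F_i = E_i^0 + E_i^1],
    where [E_i^c] accepts block [i] on challenge [c]. A state of one block is a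
    prover for [Pi] that keeps the [n] qubits as its memory, measures them in basis
    [c] and answers with the unmasked string; soundness of [Pi] on all such states
    says [F_i <= 1], and then the tensor product is also at most [1]. *)

Require Import Defs.
From mathcomp Require Import all_boot all_order all_algebra.
From mathcomp Require Import spectral sesquilinear complex.
From mathcomp Require Import reals.
Import Order.TTheory GRing.Theory Num.Theory.
Local Open Scope ring_scope.
Local Open Scope sesquilinear_scope.

Set Implicit Arguments.
Unset Strict Implicit.
Unset Printing Implicit Defensive.

(** * Positive operators, their complements and effects *)

Section Psd.
Variable C : numClosedFieldType.


Lemma qentB (T : finType) (A B : qop C T) s t :
  qent (A - B : qop C T) s t = qent A s t - qent B s t.
Proof. by rewrite /qent !mxE. Qed.

Lemma psd_sum (T I : finType) (P : pred I) (F : I -> qop C T) :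
  (forall i, P i -> psd (F i)) -> psd (\sum_(i | P i) F i).
Proof.
move=> pF; split.
  rewrite hermE; apply/eqP/matrixP => i j; rewrite !mxE !summxE rmorph_sum.
  apply: eq_bigr => l Pl; have [+ _] := pF l Pl; rewrite hermE => /eqP {1}->.
  by rewrite !mxE.
move=> u; rewrite mulmx_sumr mulmx_suml summxE sumr_ge0 // => i Pi.
by have [_] := pF i Pi; apply.
Qed.

Lemma psd_scale (T : finType) (a : C) (A : qop C T) :
  0 <= a -> psd A -> psd (a *: A).
Proof.
move=> a0 [hA pA]; split.
  move: hA; rewrite !hermE => /eqP hA.
  by rewrite linearZ /= map_mxZ /= -hA conj_Creal // ger0_real.
by move=> u; rewrite -scalemxAr -scalemxAl mxE mulr_ge0.
Qed.

Lemma psd_compl_herm (T : finType) (A : qop C T) :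
  psd A -> (1%:M - A : qop C T) \is hermsymmx.
Proof.
move=> [hA _]; move: hA; rewrite !hermE => /eqP hA.
by rewrite linearB /= map_mxB /= -hA trmx1 map_mx1.
Qed.

(** Writing [B] as [G ^t* *m G] turns the trace into the sum of the quadratic form of [A] over the
    rows of [G]. *)
Lemma psd_mul_tr_ge0 (T : finType) (A B : qop C T) :
  psd A -> psd B -> 0 <= \tr (A *m B).
Proof.
move=> [_ pA] /gram_psd[G ->].
rewrite mulmxA mxtrace_mulC mulmxA sumr_ge0 // => i _.
have := pA (row i G); congr (0 <= _).
rewrite -row_mul !mxE; apply: eq_bigr => j _; by rewrite !mxE.
Qed.

Lemma tr_compl_mul (T : finType) (A : qop C T) (r : density C T) :
  \tr ((1%:M - A) *m density_op r) = 1 - \tr (A *m density_op r).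
Proof. by rewrite mulmxBl mul1mx linearB /= density_tr. Qed.

Lemma dot_row_gt0 m (u : 'rV[C]_m) : u != 0 -> 0 < (u *m u ^t*) 0 0.
Proof.
have ge j : 0 <= u 0 j * (u 0 j)^* by exact: mul_conjC_ge0.
have e : (u *m u ^t*) 0 0 = \sum_j u 0 j * (u 0 j)^*.
  by rewrite mxE; apply: eq_bigr => j _; rewrite !mxE.
move=> u0; rewrite e lt0r sumr_ge0 // andbT; apply: contra u0.
rewrite psumr_eq0 // => /allP z; apply/eqP/rowP => j.
by have /implyP := z j (mem_index_enum _); rewrite mul_conjC_eq0 mxE => /(_ isT)/eqP.
Qed.

(** A nonzero [u], normalised, gives a pure state on which the trace is the form of [A] at [u] up to
    a positive factor. In this way a bound on all prover states becomes an operator inequality. *)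
Lemma psd_of_density (T : finType) (A : qop C T) :
  A \is hermsymmx ->
  (forall r : density C T, 0 <= \tr (A *m density_op r)) -> psd A.
Proof.
move=> hA pA; split=> // u; have [->|u0] := eqVneq u 0.
  by rewrite !mul0mx mxE.
have d0 := dot_row_gt0 u0; set d := (u *m u ^t*) 0 0 in d0.
have ps : psd (d^-1 *: (u ^t* *m u) : qop C T).
  by apply: psd_scale; [rewrite invr_ge0 ltW | exact: psd_gram].
have tr1 : \tr (d^-1 *: (u ^t* *m u)) = 1.
  by rewrite mxtraceZ mxtrace_mulC trace_mx11 mulVf // gt_eqF.
have := pA (Density ps tr1); rewrite /= -scalemxAr mxtraceZ pmulr_rge0 ?invr_gt0 //.
by rewrite mulmxA mxtrace_mulC trace_mx11 mulmxA.
Qed.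

(** Distributivity over a product set; it will apply because acceptance is a conjunction over the
    blocks. *)
Lemma qtensn_sum_dep (I J T : finType) (P : I -> pred J) (F : I -> J -> qop C T) :
  \sum_(f : {ffun I -> J} | [forall i, P i (f i)]) qtensn (fun i => F i (f i)) =
  qtensn (fun i => \sum_(j | P i j) F i j).
Proof.
apply: qopP => s t; rewrite qent_sum qentE.
under [RHS]eq_bigr => i _ do rewrite qent_sum.
by rewrite bigA_distr_big_dep; apply: eq_bigr => f _; rewrite qentE.
Qed.

(** Expanding the tensor product of the sums [F i + (1 - F i)] writes the identity as a sum of
    positive operators; removing the term made of all the [F i] leaves the complement. *)
Lemma psd_compl_tensn (I T : finType) (F : I -> qop C T) :
  (forall i, psd (F i)) -> (forall i, psd (1%:M - F i : qop C T)) ->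
  psd (1%:M - qtensn F : qop C {ffun I -> T}).
Proof.
move=> pF pF'; pose G i b := if b then F i else 1%:M - F i.
have -> : 1%:M - qtensn F =
    \sum_(f : {ffun I -> bool} | f != [ffun=> true]) qtensn (fun i => G i (f i)).
  have := qtensn_sum G; rewrite (bigD1 [ffun=> true]) //=.
  rewrite (eq_qtensn (G := F)) => [|i]; last by rewrite ffunE.
  rewrite [RHS](eq_qtensn (G := fun=> 1%:M)) => [|i]; last first.
    by rewrite big_bool /= addrC subrK.
  by rewrite qtensn1 => e; apply: (canLR (addrK _)); rewrite -e addrC.
by apply: psd_sum => f _; apply: psd_tensn => i; rewrite /G; case: (f i).
Qed.

(** The POVM element of outcome [o]: the probability of [o] depends on the measurement operator only
    through it. *)
Definition effect (T O : finType) (M : measurement C T O) (o : O) : qop C T :=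
  (M o) ^t* *m M o.

Lemma psd_effect (T O : finType) (M : measurement C T O) o : psd (effect M o).
Proof. exact: psd_gram. Qed.

Lemma effect_mtens (S T O P : finType) (M : measurement C S O)
    (N : measurement C T P) op :
  effect (mtens M N) op = qtens (effect M op.1) (effect N op.2).
Proof. by rewrite /effect /= qtens_adj qtens_mul. Qed.

Lemma effect_mtensn (I T O : finType) (M : I -> measurement C T O) f :
  effect (mtensn M) f = qtensn (fun i => effect (M i) (f i)).
Proof. by rewrite /effect /= qtensn_adj qtensn_mul. Qed.

Lemma qtens_suml (S T I : finType) (P : pred I) (F : I -> qop C S) (B : qop C T) :
  qtens (\sum_(i | P i) F i) B = \sum_(i | P i) qtens (F i) B.
Proof.
apply: qopP => s t; rewrite qentE !qent_sum mulr_suml.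
by apply: eq_bigr => i _; rewrite qentE.
Qed.

(** By completeness of [N], the difference is the sum of the tensor products of [1 - F o] with the
    effects of [N]. In the application [o] is the prover's memory outcome, which fixes the classical
    message and hence [F o]. *)
Lemma psd_1_tensB (S T O : finType) (F : O -> qop C S) (N : measurement C T O) :
  (forall o, psd (1%:M - F o : qop C S)) ->
  psd (1%:M - \sum_o qtens (F o) (effect N o) : qop C (S * T)%type).
Proof.
move=> pF.
have -> : 1%:M - \sum_o qtens (F o) (effect N o) =
    \sum_o qtens (1%:M - F o) (effect N o).
  have -> : (1%:M : qop C (S * T)%type) = \sum_o qtens 1%:M (effect N o).
    rewrite -qtens1 -(meas_complete N); apply: qopP => s t.
    rewrite qentE !qent_sum mulr_sumr.
    by apply: eq_bigr => o _; rewrite [RHS]qentE.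
  rewrite -sumrB; apply: eq_bigr => o _; apply: qopP => s t.
  by rewrite qentB !qentE qentB mulrBl.
by apply: psd_sum => o _; apply: psd_tens; [exact: pF | exact: psd_effect].
Qed.

End Psd.

(** * Acceptance operators and the soundness bound *)

Section Soundness.
Variable R : realType.

Lemma bornE (T O : finType) (r : density R[i] T) (M : measurement R[i] T O) o :
  born r M o = complex.Re (\tr (effect M o *m density_op r)).
Proof. by rewrite /born mxtrace_mulC mulmxA. Qed.

Lemma Re_tr_sum m (I : finType) (P : pred I) (F : I -> 'M[R[i]]_m) :
  complex.Re (\tr (\sum_(i | P i) F i)) = \sum_(i | P i) complex.Re (\tr (F i)).
Proof.
apply: (big_morph (fun A => complex.Re (\tr A))) => [A B|].
  by rewrite mxtraceD raddfD.
by rewrite mxtrace0 raddf0.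
Qed.

Lemma sum_bornE (T O : finType) (P : pred O) (r : density R[i] T)
    (M : measurement R[i] T O) :
  \sum_(o | P o) born r M o =
  complex.Re (\tr ((\sum_(o | P o) effect M o) *m density_op r)).
Proof.
by rewrite mulmx_suml Re_tr_sum; apply: eq_bigr => o _; exact: bornE.
Qed.

Lemma Re_tr_le1 (T : finType) (A : qop R[i] T) (r : density R[i] T) :
  psd (1%:M - A : qop R[i] T) -> complex.Re (\tr (A *m density_op r)) <= 1.
Proof.
move=> /psd_mul_tr_ge0 /(_ (density_psd r)).
rewrite tr_compl_mul; case: (\tr _) => a b.
by rewrite lecE /= subr_ge0 => /andP[].
Qed.

Variables (k n : nat) (Pi : xi_protocol R).
Variable hash : forall x, hash_family n (xi_len Pi x).
Variable x : instance.

(** For a fixed classical message, the verifier's decoding depends only on the challenge and the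
    measured string, so it can serve as the post-processing of a prover for [Pi]. *)
Definition unmask (m : nip_msg1 hash x) (c : bool) (xs : bits n) :
    bits (xi_len Pi x) :=
  xorb_bits (m.2 c) (hfun (m.1.2 c) (sub_basis m.1.1 xs c)).

Definition block_meas (c : bool) := mtens (Vmeas Pi x c) (bb84_meas R[i] n c).

Definition block_accept (m : nip_msg1 hash x) (c : bool) :
    qop R[i] (nip_reg1 n Pi x) :=
  \sum_(ao | V ao.1 c (unmask m c ao.2)) effect (block_meas c) ao.

Lemma psd_block_accept m : psd (\sum_c block_accept m c).
Proof.
by apply: psd_sum => c _; apply: psd_sum => ao _; exact: psd_effect.
Qed.

Definition block_prover (m : nip_msg1 hash x)
    (r : density R[i] (xi_reg Pi x * bits n)%type) :
    xi_prover R (xi_reg Pi x) (bits (xi_len Pi x)) :=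
  {| xp_state := r; xp_meas := bb84_meas R[i] n; xp_resp := unmask m |}.

(** The acceptance probability of [block_prover m r] is half the trace of the summed operator
    against [r], so the bound [2^-1] gives trace at most 1 for every [r], entangled or not. *)
Lemma psd_compl_block_accept (m : nip_msg1 hash x) :
  (forall P : xi_prover R (xi_reg Pi x) (bits (xi_len Pi x)),
    xi_accept P <= 2^-1) ->
  psd (1%:M - \sum_c block_accept m c : qop R[i] (nip_reg1 n Pi x)).
Proof.
move=> Pi_sound; apply: psd_of_density => [|r].
  exact: psd_compl_herm (psd_block_accept m).
have := Pi_sound (block_prover m r); rewrite /xi_accept /=.
under eq_bigr => c _ do rewrite sum_bornE.
rewrite -[leRHS]mulr1 ler_pM2l ?invr_gt0 ?ltr0n // -Re_tr_sum -mulmx_suml => le1.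
(* [le1] concerns real parts only; the order on [R[i]] also asks that the trace be real, which
   positivity provides. *)
have := psd_mul_tr_ge0 (psd_block_accept m) (density_psd r).
rewrite tr_compl_mul; move: le1; case: (\tr _) => a b /= le1.
rewrite !lecE /= => /andP[/eqP -> _].
by rewrite subrr eqxx subr_ge0.
Qed.

(** Measurement and decision both factor over the blocks, so the sum over challenge strings is the
    expansion of a tensor product of sums. *)
Lemma sum_nip_effect (m : {ffun 'I_k -> nip_msg1 hash x}) :
  \sum_(c : bits k) \sum_(a | nip_dec c a m) effect (nip_meas n Pi x c) a =
  qtensn (fun i => \sum_c block_accept (m i) c).
Proof.
rewrite -qtensn_sum; apply: eq_bigr => c _.
rewrite -(qtensn_sum_dep
  (fun i ao => V ao.1 (c i) (unmask (m i) (c i) ao.2))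
  (fun i => effect (block_meas (c i)))).
apply: eq_big => [a|a _]; last exact: effect_mtensn.
apply: eq_forallb => i; rewrite /unmask.
by case: (a i) => ? ?; case: (m i) => -[].
Qed.

Lemma nip_accept_le (P : qnip_prover R {ffun 'I_k -> nip_reg1 n Pi x}
    {ffun 'I_k -> nip_msg1 hash x}) :
  (forall Q : xi_prover R (xi_reg Pi x) (bits (xi_len Pi x)),
    xi_accept Q <= 2^-1) ->
  @qnip_accept R (NIP k hash) x P <= 2 ^- k.
Proof.
(* There are [2 ^ k] coin strings, so the averaging factor cancels the bound and a trace at most 1
   is left to prove. *)
move=> Pi_sound; rewrite /qnip_accept /= card_ffun card_bool card_ord natrX.
rewrite -[leRHS]mulr1 ler_pM2l ?invr_gt0 ?exprn_gt0 ?ltr0n //.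
under eq_bigr => c _ do rewrite sum_bornE.
rewrite -Re_tr_sum -mulmx_suml.
(* Regroup by the prover's outcome [o]: once the message is fixed, the sum over the challenges is
   the product operator of the blocks. *)
suff -> : \sum_(c : bits k)
    \sum_(ao | nip_dec c ao.1 (@qp_msg _ _ _ P ao.2))
      effect (mtens (nip_meas n Pi x c) (qp_meas P)) ao =
    \sum_o qtens (qtensn (fun i => \sum_c block_accept (@qp_msg _ _ _ P o i) c))
             (effect (qp_meas P) o).
  apply/Re_tr_le1/psd_1_tensB => o; apply: psd_compl_tensn => i.
    exact: psd_block_accept.
  exact: psd_compl_block_accept.
under [RHS]eq_bigr => o _ do rewrite -sum_nip_effect qtens_suml.
rewrite exchange_big /=; apply: eq_bigr => c _.
under [RHS]eq_bigr => o _ do rewrite qtens_suml.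
rewrite (exchange_big_dep xpredT) //= pair_big_dep /=.
by apply: eq_bigr => -[a o] _; rewrite effect_mtens.
Qed.

End Soundness.

Theorem theorem3 (R : realType) (L : instance -> Prop) (Pi : xi_protocol R)
    (k n : nat) (hash : forall x : instance, hash_family n (xi_len Pi x))
    (Pi_sound : xi_soundness_error L Pi 2^-1) :
  qnip_soundness_error L (NIP k hash) (2 ^- k).
Proof. by move=> x Lx P; apply: nip_accept_le => Q; exact: Pi_sound. Qed.
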